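(* Let $(R,\mathfrak{m},k)$ be a commutative noetherian local ring with $\dim R=1$ and with $k$ infinite. Let $n$ be the least integer such that $\mathfrak{m}^{n}=(x)\mathfrak{m}^{n-1}$ for some parameter $x$ of $R$ and $\mathfrak{m}^{n-1}\cap \Gamma_{\mathfrak{m}}(R)=0$. Then for every integer $i\geq n$ the canonical map $$\operatorname{Ext}_R^1(R/\mathfrak{m}^i,R)\longrightarrow \varinjlim_j \operatorname{Ext}_R^1(R/\mathfrak{m}^j,R)\cong H_{\mathfrak{m}}^1(R)$$ becomes surjective after applying the functor $\operatorname{Hom}_R(R/\mathfrak{m},-)$.
   Context: Here $\mathfrak{m}^0=R$ and $n\ge 1$. A system of parameters of a $d$-dimensional local ring $(R,\mathfrak{m})$ is a sequence $x_1,\dots,x_d$ of elements of $\mathfrak{m}$ such that $\mathfrak{m}^i\subseteq (x_1,\dots,x_d)$ for some integer $i$; a parameter is an element of a system of parameters (so for $d=1$, an element $x\in\mathfrak{m}$ with $\mathfrak{m}^i\subseteq (x)$ for some $i$). $\Gamma_{\mathfrak{m}}(-)$ is the $\mathfrak{m}$-torsion functor, $\Gamma_{\mathfrak m}(R)=\{r\in R\mid \mathfrak{m}^i r=0 \text{ for some } i\}$, and $H^i_{\mathfrak{m}}(-)$ denotes its right derived functors (local cohomology). The direct system $\operatorname{Ext}_R^1(R/\mathfrak{m}^j,R)$ is induced by the natural surjections $R/\mathfrak{m}^{j+1}\to R/\mathfrak{m}^j$. The functor $\operatorname{Hom}_R(R/\mathfrak{m},-)$ is identified with the socle functor $\operatorname{Soc}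 M=(0:_M\mathfrak{m})$. *)

(* Defs.v *)
From HB Require Import structures.
From mathcomp Require Import all_boot all_order all_algebra.
From mathcomp Require Import generic_quotient.
From mathcomp Require Import boolp classical_sets functions cardinality.

Set Implicit Arguments.
Unset Strict Implicit.
Unset Printing Implicit Defensive.
Import GRing.Theory.
Local Open Scope ring_scope.
Local Open Scope classical_set_scope.
Local Open Scope quotient_scope.

(* Modules over a commutative ring R are lmodType R, and R as a module over
   itself is R^o, so that ideals are submodules of R^o.  Submodules are Prop
   predicates; choice and decidability are obtained classically. *)

Section Submodules.
Variables (R : comNzRingType) (M : lmodType R).

Definition is_submodule (A : set M) : Prop :=
  A 0 /\ forall (a : R) (u v : M), A u -> A v -> A (a *: u + v).

Record submodule := Submodule {
  submod_set :> M -> Prop;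
  submodP : is_submodule submod_set }.

Lemma submod0 (A : submodule) : A 0.
Proof. by case: (submodP A). Qed.

Lemma submodZD (A : submodule) a u v : A u -> A v -> A (a *: u + v).
Proof. by case: (submodP A) => _; apply. Qed.

Lemma submodD (A : submodule) u v : A u -> A v -> A (u + v).
Proof. by move=> Au Av; rewrite -[u]scale1r; apply: submodZD. Qed.

Lemma submodZ (A : submodule) a u : A u -> A (a *: u).
Proof. by move=> Au; rewrite -[_ *: _]addr0; apply: submodZD => //; apply: submod0. Qed.

Lemma submodN (A : submodule) u : A u -> A (- u).
Proof. by move=> Au; rewrite -scaleN1r; apply: submodZ. Qed.

Lemma submod_span_subproof (S : set M) : is_submodule (smallest is_submodule S).
Proof.
split=> [A [[A0 _] _] //|a u v Su Sv A SA].
by case: (SA) => -[_ Al] _; apply: Al; [apply: Su|apply: Sv].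
Qed.

Definition submod_span (S : set M) : submodule := Submodule (submod_span_subproof S).

Definition mem_submod (A : submodule) : {pred M} := fun x => `[< A x >].

Lemma mem_submodP (A : submodule) x : reflect (A x) (x \in mem_submod A).
Proof. exact: asboolP. Qed.

Lemma mem_submod_closed (A : submodule) : GRing.submod_closed (mem_submod A).
Proof.
split=> [|a u v]; first exact/mem_submodP/submod0.
by move=> /mem_submodP Au /mem_submodP Av; apply/mem_submodP/submodZD.
Qed.

HB.instance Definition _ (A : submodule) :=
  GRing.isSubmodClosed.Build R M (mem_submod A) (mem_submod_closed A).

Definition submod (A : submodule) := {x : M | x \in mem_submod A}.

HB.instance Definition _ A := SubChoice.on (submod A).
HB.instance Definition _ A := [SubChoice_isSubLmodule of submod A by <:].

Lemma submod_valP (A : submodule) (x : submod A) : A (val x).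
Proof. exact/mem_submodP/valP. Qed.

Definition submod_sub (A : submodule) x (Ax : A x) : submod A :=
  exist _ x (introT (mem_submodP A x) Ax).

End Submodules.

Section QuotientModules.
Variables (R : comNzRingType) (M : lmodType R) (A : submodule M).

Definition quot_rel : rel M := fun x y => `[< A (x - y) >].

Lemma quot_rel_equiv : equiv_class_of quot_rel.
Proof.
split=> [x|x y|y x z]; rewrite /quot_rel.
- by rewrite subrr; apply/asboolP/submod0.
- by apply/asboolP/asboolP => /submodN; rewrite opprB.
- move=> /asboolP h1 /asboolP h2; apply/asboolP.
  by have := submodD h1 h2; rewrite addrA subrK.
Qed.

Canonical quot_rel_equivrel := EquivRelPack quot_rel_equiv.

Definition quotmod := {eq_quot quot_rel}.
HB.instance Definition _ := Choice.on quotmod.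
HB.instance Definition _ := EqQuotient.on quotmod.

Lemma quot_eqP (x y : M) : (\pi_quotmod x = \pi_quotmod y) <-> A (x - y).
Proof.
by split=> [/eqquotP/asboolP|h] //; apply/eqquotP/asboolP.
Qed.

Lemma quot_reprP (x : M) : A (repr (\pi_quotmod x) - x).
Proof. by apply/quot_eqP; rewrite reprK. Qed.

Lemma quot_pi_ex (u : quotmod) : exists x, \pi_quotmod x = u.
Proof. by exists (repr u); apply: reprK. Qed.

Definition quot_zero : quotmod := \pi_quotmod 0.
Definition quot_opp (u : quotmod) : quotmod := \pi_quotmod (- repr u).
Definition quot_add (u v : quotmod) : quotmod := \pi_quotmod (repr u + repr v).
Definition quot_scale (a : R) (u : quotmod) : quotmod := \pi_quotmod (a *: repr u).

Lemma quot_oppE x : quot_opp (\pi_quotmod x) = \pi_quotmod (- x).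
Proof. by apply/quot_eqP; rewrite -opprD; apply/submodN/quot_reprP. Qed.

Lemma quot_addE x y :
  quot_add (\pi_quotmod x) (\pi_quotmod y) = \pi_quotmod (x + y).
Proof.
by apply/quot_eqP; rewrite opprD addrACA; apply: submodD; apply: quot_reprP.
Qed.

Lemma quot_scaleE a x : quot_scale a (\pi_quotmod x) = \pi_quotmod (a *: x).
Proof. by apply/quot_eqP; rewrite -scalerBr; apply/submodZ/quot_reprP. Qed.

Lemma quot_addA : associative quot_add.
Proof. by move=> u v w; case: (quot_pi_ex u) => x <-; case: (quot_pi_ex v) => y <-; case: (quot_pi_ex w) => z <-; rewrite !quot_addE addrA. Qed.
Lemma quot_addC : commutative quot_add.
Proof. by move=> u v; case: (quot_pi_ex u) => x <-; case: (quot_pi_ex v) => y <-; rewrite !quot_addE addrC. Qed.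
Lemma quot_add0 : left_id quot_zero quot_add.
Proof. by move=> u; case: (quot_pi_ex u) => x <-; rewrite quot_addE add0r. Qed.
Lemma quot_addN : left_inverse quot_zero quot_opp quot_add.
Proof. by move=> u; case: (quot_pi_ex u) => x <-; rewrite quot_oppE quot_addE addNr. Qed.

HB.instance Definition _ :=
  GRing.isZmodule.Build quotmod quot_addA quot_addC quot_add0 quot_addN.

Lemma quot_scaleA a b v : quot_scale a (quot_scale b v) = quot_scale (a * b) v.
Proof. by case: (quot_pi_ex v) => x <-; rewrite !quot_scaleE scalerA. Qed.
Lemma quot_scale1 : left_id 1 quot_scale.
Proof. by move=> u; case: (quot_pi_ex u) => x <-; rewrite quot_scaleE scale1r. Qed.
Lemma quot_scaleDr : right_distributive quot_scale +%R.
Proof.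
move=> a u v; case: (quot_pi_ex u) => x <-; case: (quot_pi_ex v) => y <-.
by rewrite [_ + _]quot_addE !quot_scaleE [RHS]quot_addE scalerDr.
Qed.
Lemma quot_scaleDl v : {morph quot_scale^~ v : a b / a + b}.
Proof.
move=> a b; case: (quot_pi_ex v) => x <-.
by rewrite !quot_scaleE [RHS]quot_addE scalerDl.
Qed.

HB.instance Definition _ := GRing.Zmodule_isLmodule.Build R quotmod
  quot_scaleA quot_scale1 quot_scaleDr quot_scaleDl.

Definition quot_pi (x : M) : quotmod := \pi_quotmod x.

Lemma quot_pi_linear : linear quot_pi.
Proof.
by move=> a x y; rewrite /quot_pi -quot_addE -quot_scaleE.
Qed.
HB.instance Definition _ := GRing.isLinear.Build R M quotmod _ quot_pi quot_pi_linear.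

Lemma quot_piP (x y : M) : quot_pi x = quot_pi y <-> A (x - y).
Proof. exact: quot_eqP. Qed.

Lemma quot_pi_surj (u : quotmod) : exists x, quot_pi x = u.
Proof. exact: quot_pi_ex. Qed.

End QuotientModules.

Arguments quot_pi {R M} A _.



Section QuotientLift.
Variables (R : comNzRingType) (M N : lmodType R) (A : submodule M).
Variables (f : {linear M -> N}) (fA : forall x, A x -> f x = 0).

Definition quot_lift_fun of (forall x, A x -> f x = 0) : quotmod A -> N :=
  fun u => f (repr u).

Lemma quot_lift_funE x : quot_lift_fun fA (quot_pi A x) = f x.
Proof.
by apply/eqP; rewrite -subr_eq0 -linearB; apply/eqP/fA/(quot_reprP A).
Qed.

Lemma quot_lift_linear : linear (quot_lift_fun fA).
Proof.
move=> a u v; have [x <-] := quot_pi_surj u; have [y <-] := quot_pi_surj v.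
by rewrite -linearP !quot_lift_funE linearP.
Qed.
HB.instance Definition _ :=
  GRing.isLinear.Build R (quotmod A) N _ (quot_lift_fun fA) quot_lift_linear.

Definition quot_lift : {linear quotmod A -> N} := quot_lift_fun fA.

Lemma quot_liftE x : quot_lift (quot_pi A x) = f x.
Proof. exact: quot_lift_funE. Qed.

End QuotientLift.

Section SubmoduleMap.
Variables (R : comNzRingType) (M N : lmodType R).
Variables (A : submodule M) (B : submodule N) (f : {linear M -> N}).
Variable fAB : forall x, A x -> B (f x).

Definition submod_map_fun of (forall x, A x -> B (f x)) : submod A -> submod B :=
  fun x => submod_sub (fAB (submod_valP x)).

Lemma submod_map_linear : linear (submod_map_fun fAB).
Proof. by move=> a x y; apply: val_inj; rewrite /= linearP. Qed.
HB.instance Definition _ :=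
  GRing.isLinear.Build R (submod A) (submod B) _ (submod_map_fun fAB) submod_map_linear.

Definition submod_map : {linear submod A -> submod B} := submod_map_fun fAB.

Lemma val_submod_map x : val (submod_map x) = f (val x).
Proof. by []. Qed.

End SubmoduleMap.

Section HomModules.
Variable R : comNzRingType.

Definition linHom (M N : lmodType R) : Type := {linear M -> N}.

Section HomModule.
Variables M N : lmodType R.

Lemma linHom_ext (f g : linHom M N) : f =1 g -> f = g.
Proof.
case: f g => f cf [g cg] /= /funext fg; move: fg cf cg => -> cf cg.
congr (GRing.Linear.Pack _); case: cf cg => [[a] [b]] [[c] [d]].
by congr (GRing.Linear.Class _ _); congr (_ _); apply: Prop_irrelevance.
Qed.

HB.instance Definition _ := gen_eqMixin (linHom M N).
HB.instance Definition _ := gen_choiceMixin (linHom M N).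

Definition hom_zero : linHom M N := (\0%R : {linear M -> N}).
Definition hom_opp (f : linHom M N) : linHom M N := (\- f : {linear M -> N}).
Definition hom_add (f g : linHom M N) : linHom M N := (f \+ g : {linear M -> N}).
Definition hom_scale (a : R) (f : linHom M N) : linHom M N := (a \*: f : {linear M -> N}).

Lemma hom_addA : associative hom_add.
Proof. by move=> f g h; apply: linHom_ext => x /=; rewrite addrA. Qed.
Lemma hom_addC : commutative hom_add.
Proof. by move=> f g; apply: linHom_ext => x /=; rewrite addrC. Qed.
Lemma hom_add0 : left_id hom_zero hom_add.
Proof. by move=> f; apply: linHom_ext => x /=; rewrite add0r. Qed.
Lemma hom_addN : left_inverse hom_zero hom_opp hom_add.
Proof. by move=> f; apply: linHom_ext => x /=; rewrite addNr. Qed.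

HB.instance Definition _ :=
  GRing.isZmodule.Build (linHom M N) hom_addA hom_addC hom_add0 hom_addN.

Lemma hom_scaleA a b f : hom_scale a (hom_scale b f) = hom_scale (a * b) f.
Proof. by apply: linHom_ext => x /=; rewrite scalerA. Qed.
Lemma hom_scale1 : left_id 1 hom_scale.
Proof. by move=> f; apply: linHom_ext => x /=; rewrite scale1r. Qed.
Lemma hom_scaleDr : right_distributive hom_scale +%R.
Proof. by move=> a f g; apply: linHom_ext => x /=; rewrite scalerDr. Qed.
Lemma hom_scaleDl f : {morph hom_scale^~ f : a b / a + b}.
Proof. by move=> a b; apply: linHom_ext => x /=; rewrite scalerDl. Qed.

HB.instance Definition _ := GRing.Zmodule_isLmodule.Build R (linHom M N)
  hom_scaleA hom_scale1 hom_scaleDr hom_scaleDl.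

End HomModule.

Section HomFunctor.
Variables M N P : lmodType R.

Definition hom_post_fun (g : {linear N -> P}) (f : linHom M N) : linHom M P :=
  (g \o f : {linear M -> P}).

Lemma hom_post_linear g : linear (hom_post_fun g).
Proof. by move=> a u v; apply: linHom_ext => x /=; rewrite linearP. Qed.
HB.instance Definition _ g :=
  GRing.isLinear.Build R (linHom M N) (linHom M P) _ (hom_post_fun g) (hom_post_linear g).

Definition hom_pre_fun (g : {linear M -> N}) (f : linHom N P) : linHom M P :=
  (f \o g : {linear M -> P}).

Lemma hom_pre_linear g : linear (hom_pre_fun g).
Proof. by move=> a u v; apply: linHom_ext => x. Qed.
HB.instance Definition _ g :=
  GRing.isLinear.Build R (linHom N P) (linHom M P) _ (hom_pre_fun g) (hom_pre_linear g).

End HomFunctor.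

Definition hom_post (M N P : lmodType R) (g : {linear N -> P}) :
  {linear linHom M N -> linHom M P} := hom_post_fun g.

Definition hom_pre (M N P : lmodType R) (g : {linear M -> N}) :
  {linear linHom N P -> linHom M P} := hom_pre_fun g.

End HomModules.

Arguments hom_post {R} M {N P} g.
Arguments hom_pre {R M N} P g.

Section Cohomology.
Variable R : comNzRingType.

Record cochain_complex := CochainComplex {
  cx_obj :> nat -> lmodType R;
  cx_d : forall n, {linear cx_obj n -> cx_obj n.+1};
  cx_dd : forall n x, cx_d n.+1 (cx_d n x) = 0 }.

Record cochain_map (C D : cochain_complex) := CochainMap {
  cm_fun :> forall n, {linear C n -> D n};
  cm_comm : forall n x, cm_fun n.+1 (cx_d C n x) = cx_d D n (cm_fun n x) }.

Section Objects.
Variable C : cochain_complex.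

Lemma cocycles_subproof n : is_submodule (fun x : C n => cx_d C n x = 0).
Proof. by split=> [|a u v du dv]; rewrite ?linear0 // linearP du dv scaler0 addr0. Qed.
Definition cocycles n : submodule (C n) := Submodule (cocycles_subproof n).

Definition is_coboundary n : C n -> Prop :=
  match n with
  | 0 => fun x => x = 0
  | k.+1 => fun x => exists y, cx_d C k y = x
  end.

Lemma coboundaries_subproof n :
  is_submodule (fun z : submod (cocycles n) => is_coboundary (val z)).
Proof.
split; case: n => [|n] //=; first by exists 0; rewrite linear0.
- by move=> a u v /= -> ->; rewrite scaler0 addr0.
- by move=> a u v /= [x <-] [y <-]; exists (a *: x + y); rewrite linearP.
Qed.
Definition coboundaries n : submodule (submod (cocycles n)) :=
  Submodule (coboundaries_subproof n).

Definition cohomology n : lmodType R := quotmod (coboundaries n).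

End Objects.

Section Maps.
Variables (C D : cochain_complex) (f : cochain_map C D) (n : nat).

Lemma cm_cocycles x : cocycles C n x -> cocycles D n (f n x).
Proof. by rewrite /= -cm_comm => ->; rewrite linear0. Qed.

Definition cocycles_map : {linear submod (cocycles C n) -> submod (cocycles D n)} :=
  submod_map cm_cocycles.

Lemma cm_coboundaries z : coboundaries C n z ->
  (quot_pi (coboundaries D n) \o cocycles_map) z = 0.
Proof.
move=> Bz; rewrite /= -[RHS](linear0 (quot_pi (coboundaries D n))).
apply/quot_piP; rewrite subr0 /=; move: z Bz; rewrite /cocycles_map /=.
move: (cm_cocycles); case: n => [|k] h z /=; first by move=> ->; rewrite linear0.
by move=> [y <-]; exists (f k y); rewrite cm_comm.
Qed.

Definition cohomology_map : {linear cohomology C n -> cohomology D n} :=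
  quot_lift cm_coboundaries.

End Maps.
End Cohomology.

Arguments cohomology {R} C n.
Arguments cohomology_map {R C D} f n.

Section DerivedFunctors.
Variable R : comNzRingType.

Definition injective_module (E : lmodType R) : Prop :=
  forall (M N : lmodType R) (f : {linear M -> N}) (g : {linear M -> E}),
    injective f -> exists h : {linear N -> E}, forall x, h (f x) = g x.

Record injective_resolution (N : lmodType R) := InjectiveResolution {
  res_cx :> cochain_complex R;
  res_aug : {linear N -> res_cx 0};
  res_injective : forall n, injective_module (res_cx n);
  res_aug_inj : injective res_aug;
  res_exact0 : forall x, cx_d res_cx 0 x = 0 <-> exists y, res_aug y = x;
  res_exact : forall n x,
    cx_d res_cx n.+1 x = 0 <-> exists y, cx_d res_cx n y = x }.

Lemma hom_cx_dd (M : lmodType R) (C : cochain_complex R) n (f : linHom M (C n)) :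
  hom_post M (cx_d C n.+1) (hom_post M (cx_d C n) f) = 0.
Proof. by apply: linHom_ext => x /=; rewrite cx_dd. Qed.

Definition hom_cx (M : lmodType R) (C : cochain_complex R) : cochain_complex R :=
  @CochainComplex R (fun n => linHom M (C n)) (fun n => hom_post M (cx_d C n))
    (@hom_cx_dd M C).

Lemma hom_cx_pre_comm (M M' : lmodType R) (g : {linear M -> M'})
    (C : cochain_complex R) n (f : hom_cx M' C n) :
  hom_pre _ g (cx_d (hom_cx M' C) n f) = cx_d (hom_cx M C) n (hom_pre _ g f).
Proof. exact: linHom_ext. Qed.

Definition hom_cx_pre (M M' : lmodType R) (g : {linear M -> M'})
    (C : cochain_complex R) : cochain_map (hom_cx M' C) (hom_cx M C) :=
  @CochainMap R (hom_cx M' C) (hom_cx M C) (fun n => hom_pre (C n) g)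
    (@hom_cx_pre_comm M M' g C).

(* Right derived functors are computed on a given injective resolution E of the
   module N: Ext^n(M, N) is H^n(Hom(M, E)), contravariant in M, with g : M -> M' giving
   Ext^n(M', N) -> Ext^n(M, N).  Below, H^n_m(N) is likewise H^n(Gamma_m(E)). *)
Definition Ext (n : nat) (M N : lmodType R) (E : injective_resolution N) : lmodType R :=
  cohomology (hom_cx M E) n.

Definition Ext_pre (n : nat) (M M' N : lmodType R) (E : injective_resolution N)
    (g : {linear M -> M'}) : {linear Ext n M' E -> Ext n M E} :=
  cohomology_map (hom_cx_pre g E) n.

End DerivedFunctors.

Section Ideals.
Variable R : comNzRingType.

Definition ideal := submodule R^o.

Lemma idealT_subproof : is_submodule (fun _ : R^o => True).
Proof. by []. Qed.
Definition idealT : ideal := Submodule idealT_subproof.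

Definition idealM (I J : ideal) : ideal :=
  submod_span [set x : R^o | exists a b : R, [/\ I a, J b & x = a * b]].

(* I^0 is the unit ideal. *)
Definition idealX (I : ideal) (n : nat) : ideal := iter n (idealM I) idealT.

Definition maximal_ideal (I : ideal) : Prop :=
  ~ I 1 /\ forall J : ideal, I `<=` J -> ~ J 1 -> J `<=` I.

Definition prime_ideal (I : ideal) : Prop :=
  ~ I 1 /\ forall a b : R, I (a * b) -> I a \/ I b.

Definition is_noetherian : Prop :=
  forall I : ideal, exists s : seq R^o, I = submod_span [set x | x \in s] :> set R.

Definition is_local (m : ideal) : Prop :=
  maximal_ideal m /\ forall I : ideal, maximal_ideal I -> I = m :> set R.

(* Strict chains P 0 < ... < P d of primes; P is irrelevant beyond d. *)
Definition prime_chain (d : nat) : Prop :=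
  exists P : nat -> ideal,
    (forall i, (i <= d)%N -> prime_ideal (P i)) /\
    (forall i, (i < d)%N -> P i `<` P i.+1).

Definition krull_dim (d : nat) : Prop :=
  prime_chain d /\ forall d', prime_chain d' -> (d' <= d)%N.

Definition system_of_parameters (m : ideal) (s : seq R^o) : Prop :=
  [/\ krull_dim (size s), forall x, x \in s -> m x &
      exists i, idealX m i `<=` submod_span [set x | x \in s]].

Definition is_parameter (m : ideal) (x : R^o) : Prop :=
  exists2 s : seq R^o, system_of_parameters m s & x \in s.

Lemma idealX_decr (I : ideal) n : idealX I n.+1 `<=` idealX I n.
Proof.
apply: smallest_sub => [|x [a [b [_ Jb ->]]]]; first exact: submodP.
exact: (submodZ (A := idealX I n)).
Qed.

End Ideals.

Section LocalCohomology.
Variables (R : comNzRingType) (m : ideal R).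

Lemma torsion_subproof (M : lmodType R) :
  is_submodule (fun x : M => exists i, forall a, idealX m i a -> a *: x = 0).
Proof.
have mono i j : (i <= j)%N -> idealX m j `<=` idealX m i.
  move=> /subnKC <-; elim: (j - i)%N => [|k IH]; first by rewrite addn0.
  by rewrite addnS; apply: subset_trans IH; apply: idealX_decr.
split=> [|a u v [i hi] [j hj]]; first by exists 0%N => a _; rewrite scaler0.
exists (maxn i j) => b mb; rewrite scalerDr scalerA mulrC -scalerA.
by rewrite hi ?hj ?scaler0 ?addr0 //; apply: mono mb; rewrite ?leq_maxl ?leq_maxr.
Qed.

(* Gamma_m(M) *)
Definition torsion (M : lmodType R) : submodule M := Submodule (torsion_subproof M).

Lemma torsion_map_subproof (M N : lmodType R) (f : {linear M -> N}) x :
  torsion M x -> torsion N (f x).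
Proof. by move=> [i hi]; exists i => a ma; rewrite -linearZ hi ?linear0. Qed.

Definition torsion_map (M N : lmodType R) (f : {linear M -> N}) :
  {linear submod (torsion M) -> submod (torsion N)} :=
  submod_map (torsion_map_subproof f).

Lemma torsion_cx_dd (C : cochain_complex R) n x :
  torsion_map (cx_d C n.+1) (torsion_map (cx_d C n) x) = 0.
Proof. by apply: val_inj; rewrite /= cx_dd. Qed.

Definition torsion_cx (C : cochain_complex R) : cochain_complex R :=
  @CochainComplex R (fun n => submod (torsion (C n)))
    (fun n => torsion_map (cx_d C n)) (@torsion_cx_dd C).

Definition local_cohomology (n : nat) (N : lmodType R) (E : injective_resolution N) :
  lmodType R := cohomology (torsion_cx E) n.

(* R/m^i *)
Definition powquot (i : nat) : lmodType R := quotmod (idealX m i).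

Lemma powquot_proj_subproof i x :
  idealX m i.+1 x -> quot_pi (idealX m i) x = 0.
Proof.
move=> mx; rewrite -[RHS](linear0 (quot_pi (idealX m i))).
by apply/quot_piP; rewrite subr0; apply: idealX_decr.
Qed.

Definition powquot_proj (i : nat) : {linear powquot i.+1 -> powquot i} :=
  quot_lift (@powquot_proj_subproof i).

Lemma ev1_subproof (M : lmodType R) i (f : linHom (powquot i) M) :
  torsion M (f (quot_pi (idealX m i) 1)).
Proof.
exists i => a ma; rewrite -linearZ -linearZ /= [_ *: 1]mulr1.
suff -> : quot_pi (idealX m i) a = 0 by rewrite linear0.
rewrite -[RHS](linear0 (quot_pi (idealX m i))).
by apply/quot_piP; rewrite subr0.
Qed.

(* Hom(R/m^i, M) -> Gamma_m(M), f |-> f(1), identifies Hom(R/m^i, M) with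
   (0 :_M m^i); it is natural in M and in i, and induces the canonical maps
   Ext^n(R/m^i, N) -> H^n_m(N). *)
Definition ev1_fun (M : lmodType R) i (f : linHom (powquot i) M) : submod (torsion M) :=
  submod_sub (ev1_subproof f).

Lemma ev1_linear (M : lmodType R) i : linear (@ev1_fun M i).
Proof. by move=> a f g; apply: val_inj. Qed.
HB.instance Definition _ (M : lmodType R) i :=
  GRing.isLinear.Build R (linHom (powquot i) M) (submod (torsion M)) _
    (@ev1_fun M i) (@ev1_linear M i).

Definition ev1 (M : lmodType R) i :
  {linear linHom (powquot i) M -> submod (torsion M)} := @ev1_fun M i.

Lemma ev1_comm (C : cochain_complex R) i n (f : hom_cx (powquot i) C n) :
  ev1 (C n.+1) i (cx_d (hom_cx (powquot i) C) n f) =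
  cx_d (torsion_cx C) n (ev1 (C n) i f).
Proof. exact: val_inj. Qed.

Definition ev1_cx (C : cochain_complex R) i :
    cochain_map (hom_cx (powquot i) C) (torsion_cx C) :=
  @CochainMap R (hom_cx (powquot i) C) (torsion_cx C) (fun n => ev1 (C n) i)
    (@ev1_comm C i).

Definition Ext_to_local_cohomology (n i : nat) (N : lmodType R)
    (E : injective_resolution N) :
    {linear Ext n (powquot i) E -> local_cohomology n E} :=
  cohomology_map (ev1_cx E i) n.

Definition Ext_system (n : nat) (N : lmodType R) (E : injective_resolution N)
    (j : nat) : {linear Ext n (powquot j) E -> Ext n (powquot j.+1) E} :=
  Ext_pre n E (powquot_proj j).

Definition parameter_reduction (n : nat) : Prop :=
  [/\ (0 < n)%N,
      (exists2 x : R^o, is_parameter m x &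
        idealX m n = idealM (submod_span [set x]) (idealX m n.-1) :> set R) &
      idealX m n.-1 `&` torsion R^o = [set 0]].

Definition least_nat (P : nat -> Prop) (n : nat) : Prop :=
  P n /\ forall k, P k -> (n <= k)%N.

End LocalCohomology.

Section DirectLimits.
Variables (R : comNzRingType) (M : nat -> lmodType R).
Variable t : forall j, {linear M j -> M j.+1}.

Definition is_cocone (L : lmodType R) (c : forall j, {linear M j -> L}) : Prop :=
  forall j x, c j.+1 (t j x) = c j x.

Definition is_direct_limit (L : lmodType R) (c : forall j, {linear M j -> L}) : Prop :=
  is_cocone c /\
  forall (L' : lmodType R) (c' : forall j, {linear M j -> L'}), is_cocone c' ->
    exists! h : {linear L -> L'}, forall j x, h (c j x) = c' j x.

End DirectLimits.

(* Main.v *)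
Require Import Defs.
From HB Require Import structures.
From mathcomp Require Import all_boot all_order all_algebra.
From mathcomp Require Import boolp classical_sets functions cardinality.

Set Implicit Arguments.
Unset Strict Implicit.
Unset Printing Implicit Defensive.
Import GRing.Theory.
Local Open Scope ring_scope.
Local Open Scope classical_set_scope.

(** A linear map out of [R/I] is an element killed by [I], so a cocycle of
    [Hom(R/m^j, E)] is a cocycle of [E] killed by [m^j], and the canonical maps
    into local cohomology are induced by the inclusions of [(0 :_E m^j)] into
    [Gamma_m(E)].  As [Gamma_m(E)] is the increasing union of these submodules,
    every cocycle and every primitive of the torsion complex is already present
    at a finite stage, which gives the direct limit ([cohomology_direct_limit]).

    For the socles, let [E0] and [E1] be the first two terms of [E], with [R]
    embedded in [E0].  By exactness, a class of [H^1_m(R)] is [d e] for some [e]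
    in [E0] with [m^j e] inside [R] for some [j]; it depends on [e] modulo
    [R + Gamma_m(E0)], and it is killed by [m] iff [m e] lies in
    [R + Gamma_m(E0)] ([socle_class]).  Similarly, an [e'] with [m^i e'] inside
    [R] represents a class of [Ext^1(R/m^i, R)], which is killed by [m] iff
    [m e'] lies in [R + (0 :_E0 m^i)] ([socle_lift]).  So it suffices to replace
    [e] by an [e'] of the second kind with [e' - e] torsion.

    The equality [m^n = x m^(n-1)] propagates to [m^i = x m^(i-1)] for [i >= n].
    Moreover [x] is injective on [m^(i-1)], since its annihilator is torsion and
    [m^(i-1)] meets [Gamma_m(R)] trivially.  Dividing by [x] on [m^i] therefore
    makes sense, and with [x e = r + gamma] the element [e] is approximated by
    the homomorphism [x b |-> r b] on [m^i], which is multiplication by some [e']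
    because [E0] is injective.  The same vanishing of torsion in [m^(i-1)] shows
    that [m^i] kills the torsion part of each [c e'] ([socle_representative]). *)

(** * Quotients of the ring and cohomology classes *)

Section Quotients.
Variable R : comNzRingType.

Lemma quot_pi_eq0 (M : lmodType R) (A : submodule M) (x : M) :
  quot_pi A x = 0 <-> A x.
Proof. by rewrite -[0 in X in X <-> _](linear0 (quot_pi A)) quot_piP subr0. Qed.

Lemma quot_pi_scale1 (I : ideal R) (a : R) :
  quot_pi I a = a *: quot_pi I 1.
Proof. by rewrite -linearZ /= [_ *: _]mulr1. Qed.

Lemma quot_hom_ext (I : ideal R) (M : lmodType R) (f g : linHom (quotmod I) M) :
  f (quot_pi I 1) = g (quot_pi I 1) -> f = g.
Proof.
move=> fg; apply: linHom_ext => u; have [a <-] := quot_pi_surj u.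
by rewrite quot_pi_scale1 !linearZ fg.
Qed.

Lemma quot_hom_ex (I : ideal R) (M : lmodType R) (u : M) :
  (forall a, I a -> a *: u = 0) ->
  exists f : linHom (quotmod I) M, f (quot_pi I 1) = u.
Proof.
move=> Iu.
have mulu_lin : linear (fun a : R^o => a *: u).
  by move=> a b c; rewrite scalerDl scalerA.
pose mulu : {linear R^o -> M} :=
  HB.pack (fun a : R^o => a *: u) (GRing.isLinear.Build R R^o M _ _ mulu_lin).
have mulu0 a : I a -> mulu a = 0 by exact: Iu.
by exists (quot_lift mulu0); rewrite quot_liftE /= scale1r.
Qed.

Lemma quot_hom_killed (I : ideal R) (M : lmodType R) (f : linHom (quotmod I) M) a :
  I a -> a *: f (quot_pi I 1) = 0.
Proof. by move=> Ia; rewrite -linearZ -quot_pi_scale1 (quot_pi_eq0 _ _).2 ?linear0. Qed.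

Lemma cohomology_mapE (C D : cochain_complex R) (f : cochain_map C D) n z :
  cohomology_map f n (quot_pi (coboundaries C n) z) =
  quot_pi (coboundaries D n) (cocycles_map f n z).
Proof. exact: quot_liftE. Qed.

Lemma idealX_addl (I : ideal R) i j : idealX I (i + j) `<=` idealX I j.
Proof. by elim: i => // i IH; apply: subset_trans IH; apply: idealX_decr. Qed.

End Quotients.

(** * Local cohomology as a direct limit *)

Section DirectLimitCriterion.
Variables (R : comNzRingType) (M : nat -> lmodType R).
Variable t : forall j, {linear M j -> M j.+1}.

Fixpoint transition (j k : nat) (x : M j) : M (k + j) :=
  if k is k'.+1 then t (k' + j) (transition k' x) else x.

Lemma cocone_transition (L : lmodType R) (c : forall j, {linear M j -> L}) j k
    (x : M j) : is_cocone t c -> c (k + j)%N (transition k x) = c j x.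
Proof. by move=> cc; elim: k => //= k <-; apply: cc. Qed.

(** Over linearly ordered indices any two elements have representatives at a
    common stage.  Quantifying over cocones avoids transporting elements along
    the equality of two sums of indices. *)
Lemma cocone_later j K (x : M j) : (j <= K)%N ->
  exists y : M K, forall (L : lmodType R) (c : forall j, {linear M j -> L}),
    is_cocone t c -> c K y = c j x.
Proof.
move=> /subnK <-; exists (transition (K - j) x) => L c.
exact: cocone_transition.
Qed.

(** A cocone is a colimit as soon as it is jointly surjective and every element
    it kills already dies at a later stage: the induced map sends [c j x] to
    [c' j x], and the two conditions say exactly that this is defined everywhere
    and unambiguous. *)
Lemma direct_limit_criterion (L : lmodType R) (c : forall j, {linear M j -> L}) :
  is_cocone t c ->
  (forall y, exists j x, c j x = y) ->
  (forall j (x : M j), c j x = 0 -> exists k, transition k x = 0) ->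
  is_direct_limit t c.
Proof.
move=> cc csurj cker; split=> // L' c' cc'.
have wd j1 (x1 : M j1) j2 (x2 : M j2) : c j1 x1 = c j2 x2 -> c' j1 x1 = c' j2 x2.
  have [y1 e1] := cocone_later x1 (leq_maxl j1 j2).
  have [y2 e2] := cocone_later x2 (leq_maxr j1 j2).
  rewrite -(e1 _ _ cc) -(e2 _ _ cc) -(e1 _ _ cc') -(e2 _ _ cc').
  move/eqP; rewrite -subr_eq0 -linearB => /eqP /cker[k yk0].
  by apply/eqP; rewrite -subr_eq0 -linearB -(cocone_transition k) // yk0 linear0.
have [h hE] : exists h : L -> L', forall j x, h (c j x) = c' j x.
  have /choice[h hP] y : exists z, exists j x, c j x = y /\ z = c' j x.
    by have [j [x <-]] := csurj y; exists (c' j x), j, x.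
  by exists h => j x; have [j' [x' [/wd <-]]] := hP (c j x).
have h_lin : linear h.
  move=> a y1 y2; have [j1 [x1 <-]] := csurj y1; have [j2 [x2 <-]] := csurj y2.
  have [z1 e1] := cocone_later x1 (leq_maxl j1 j2).
  have [z2 e2] := cocone_later x2 (leq_maxr j1 j2).
  by rewrite -(e1 _ _ cc) -(e2 _ _ cc) -linearP !hE linearP.
pose hL : {linear L -> L'} := HB.pack h (GRing.isLinear.Build R L L' _ h h_lin).
exists hL; split=> [j x|g gE]; first exact: hE.
apply: (@linHom_ext R L L' hL g) => y.
by have [j [x <-]] := csurj y; rewrite gE; apply: hE.
Qed.

End DirectLimitCriterion.

Section CohomologyLimit.
Variables (R : comNzRingType) (m : ideal R) (C : cochain_complex R) (n : nat).

Let hom_cohomology j : lmodType R := cohomology (hom_cx (powquot m j) C) n.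
Let step j : {linear hom_cohomology j -> hom_cohomology j.+1} :=
  cohomology_map (hom_cx_pre (powquot_proj m j) C) n.
Let to_torsion j : {linear hom_cohomology j -> cohomology (torsion_cx m C) n} :=
  cohomology_map (ev1_cx m C j) n.

Lemma powquot_proj1 j :
  powquot_proj m j (quot_pi (idealX m j.+1) 1) = quot_pi (idealX m j) 1.
Proof. exact: quot_liftE. Qed.

(** Restricting a cocycle along [R/m^(k+j) -> R/m^j] keeps its value at 1, so the
    transition maps become invisible once cocycles are read as elements of [C n]. *)
Lemma transition_class j k
    (z : submod (cocycles (hom_cx (powquot m j) C) n)) :
  exists z' : submod (cocycles (hom_cx (powquot m (k + j)) C) n),
    transition step k (quot_pi (coboundaries _ n) z) =
      quot_pi (coboundaries _ n) z' /\
    (val z' : linHom _ _) (quot_pi (idealX m (k + j)) 1) =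
      (val z : linHom _ _) (quot_pi (idealX m j) 1).
Proof.
elim: k => [|k [z' [zz' z'1]]]; first by exists z.
exists (cocycles_map (hom_cx_pre (powquot_proj m (k + j)) C) n z').
split.
  rewrite [LHS]/= zz'.
  exact: (cohomology_mapE (hom_cx_pre (powquot_proj m (k + j)) C) z').
rewrite -z'1; change (((val z' : linHom _ _)) (powquot_proj m (k + j)
  (quot_pi (idealX m (k + j).+1) 1)) = (val z' : linHom _ _) (quot_pi _ 1)).
by rewrite powquot_proj1.
Qed.

(** A torsion primitive of the value at 1 is killed by some power of [m], hence
    is itself the value at 1 of a primitive at a later stage. *)
Lemma coboundary_later j (z : submod (cocycles (hom_cx (powquot m j) C) n)) :
  coboundaries (torsion_cx m C) n (cocycles_map (ev1_cx m C j) n z) ->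
  exists k, forall z' : submod (cocycles (hom_cx (powquot m (k + j)) C) n),
    (val z' : linHom _ _) (quot_pi (idealX m (k + j)) 1) =
      (val z : linHom _ _) (quot_pi (idealX m j) 1) ->
    coboundaries (hom_cx (powquot m (k + j)) C) n z'.
Proof.
rewrite /coboundaries /=; move: z; case: n => [|p] z /=.
  move=> /(congr1 val) /= z0; exists 0%N => z' z'1.
  by apply: quot_hom_ext; rewrite z'1 z0.
move=> [y /(congr1 val) /= yz]; have [i yi] := submod_valP y.
exists i => z' z'1.
have [a|h h1] := @quot_hom_ex _ (idealX m (i + j)) _ (val y).
  by rewrite addnC => /idealX_addl /yi.
exists h; apply: quot_hom_ext; rewrite z'1 -yz.
by change (cx_d C p (h (quot_pi (idealX m (i + j)) 1)) = cx_d C p (val y)); rewrite h1.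
Qed.

(** The reason is that [Gamma_m(C n)] is the union of the submodules
    [(0 :_(C n) m^j)], which [Hom(R/m^j, C n)] is: cocycles and primitives of
    the torsion complex both appear at a finite stage. *)
Lemma cohomology_direct_limit : is_direct_limit step to_torsion.
Proof.
apply: direct_limit_criterion.
- move=> j u; have [z <-] := quot_pi_surj u.
  rewrite /step (cohomology_mapE (hom_cx_pre (powquot_proj m j) C) z).
  rewrite /to_torsion !(cohomology_mapE (ev1_cx m C _)); congr (quot_pi _ _).
  apply/val_inj/val_inj.
  (* Both sides evaluate the same homomorphism, the left one through R/m^(j+1). *)
  change (((val z : linHom _ _)) (powquot_proj m j (quot_pi (idealX m j.+1) 1)) =
    (val z : linHom _ _) (quot_pi (idealX m j) 1)).
  by rewrite powquot_proj1.
- move=> u; have [z <-] := quot_pi_surj u.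
  have [j zj] := submod_valP (val z : submod (torsion m (C n))).
  have [f f1] := quot_hom_ex zj.
  have df : cocycles (hom_cx (powquot m j) C) n f.
    apply: quot_hom_ext.
    change (cx_d C n (f (quot_pi (idealX m j) 1)) = 0); rewrite f1.
    exact: (congr1 val (submod_valP z)).
  exists j, (quot_pi _ (submod_sub df)); rewrite /to_torsion cohomology_mapE.
  by congr (quot_pi _ _); apply/val_inj/val_inj.
- move=> j u; have [z <-] := quot_pi_surj u.
  rewrite /to_torsion cohomology_mapE => /quot_pi_eq0 /coboundary_later[k zk].
  exists k; have [z' [-> z'1]] := transition_class k z.
  by apply/quot_pi_eq0/zk.
Qed.

End CohomologyLimit.

(** * Multiplication by the parameter on high powers of the maximal ideal *)

Section Reduction.
Variables (R : comNzRingType) (m : ideal R).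

Lemma multiples_submodule (x : R) (I : ideal R) :
  is_submodule (fun a : R^o => exists2 b : R, I b & a = x * b).
Proof.
split=> [|k _ _ [b Ib ->] [b' Ib' ->]].
  by exists 0; [apply: submod0|rewrite mulr0].
exists (k *: (b : R^o) + b' : R^o); first exact: submodZD.
by rewrite mulrDr [k *: (b : R^o)]/(k * b) mulrCA.
Qed.

Lemma idealM_span1 (x : R^o) (I : ideal R) a :
  idealM (submod_span [set x]) I a -> exists2 b, I b & a = x * b.
Proof.
move=> /(_ _ (conj (multiples_submodule x I) _)); apply => _ [c [d [xc Id ->]]].
have [|c' _ ->] := xc _ (conj (multiples_submodule x (idealT R)) _).
  by move=> _ ->; exists 1; rewrite ?mulr1.
by exists (c' * d); [apply: submodZ|rewrite mulrA].
Qed.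

Lemma krull_dim_inj d d' : krull_dim R d -> krull_dim R d' -> d = d'.
Proof. by move=> [cd hd] [cd' hd']; apply/eqP; rewrite eqn_leq hd ?hd'. Qed.

Lemma parameter_dim1 (x : R^o) : krull_dim R 1 -> is_parameter m x ->
  m x /\ exists t, forall a, idealX m t a -> exists b : R, a = x * b.
Proof.
move=> dim1 [s [/(krull_dim_inj dim1) + sm [t st]] xs].
case: s xs sm st => [|y [|? ?]] //; rewrite mem_seq1 => /eqP <- sm st _.
split; first by apply: sm; rewrite mem_head.
exists t => a /st sa.
have [|b _ ->] := sa _ (conj (multiples_submodule x (idealT R)) _); last by exists b.
by move=> c /=; rewrite inE => /eqP ->; exists 1; rewrite ?mulr1.
Qed.

(** Writing an element of [m^(j+2)] as a sum of products [c d] with [d] in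
    [m^(j+1)], the factor [x] comes out of [d] and [c] raises the exponent of
    the cofactor. *)
Lemma reduction_later (x : R) n i a :
  (forall a, idealX m n.+1 a -> exists2 b, idealX m n b & a = x * b) ->
  idealX m (i + n).+1 a -> exists2 b, idealX m (i + n) b & a = x * b.
Proof.
move=> hn; elim: i a => [|i IH] a; first exact: hn.
move=> /(_ _ (conj (multiples_submodule x (idealX m (i.+1 + n))) _)); apply.
move=> _ [c [d [mc md ->]]]; have [b mb ->] := IH d md.
exists (c * b); last by rewrite mulrCA.
by move=> A [_]; apply; exists c, b.
Qed.

(** A power of [m] lies in [(x)], so whatever [x] kills is killed by that power. *)
Lemma parameter_torsion (x u : R) t :
  (forall a, idealX m t a -> exists b, a = x * b) ->
  x * u = 0 -> torsion m R^o u.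
Proof.
move=> tx xu0; exists t => a /tx[b ->].
by change (x * b * u = 0); rewrite mulrAC xu0 mul0r.
Qed.

Lemma parameter_inj (x b b' : R) i t :
  (forall a, idealX m t a -> exists b, a = x * b) ->
  idealX m i `&` torsion m R^o = [set 0] ->
  idealX m i b -> idealX m i b' -> x * b = x * b' -> b = b'.
Proof.
move=> tx mi0 mb mb' xbb'; apply/eqP; rewrite -subr_eq0; apply/eqP.
suff : [set 0] (b - b') by [].
rewrite -mi0; split; first by apply: (@submodD _ _ (idealX m i)) => //; apply: submodN.
by apply: (parameter_torsion tx); rewrite mulrBr xbb' subrr.
Qed.

(** * Moving a socle class to a finite stage *)

(** The heart of the argument.  An element [e] of [E0] with [c e] in
    [R + Gamma_m(E0)] for all [c] in [m] represents a socle element of the first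
    local cohomology.  Writing [x e = r + gamma], the rule [x b |-> r b] is a
    homomorphism from [m^(i+1) = x m^i] to [m^i], because [x] is injective on
    [m^i]; as [x b e - r b = b gamma], it agrees with multiplication by [e] on the
    products [x b] with [b] in a power of [m] that kills [gamma].  It extends to
    multiplication by some [e'] of the injective module [E0].  If
    [c e' = r' + gamma'] with [gamma'] torsion, then [m^(i+1) gamma'] lies in
    [m^i], as [m^(i+1) e'] does, and is torsion, so it vanishes. *)
Lemma socle_representative (E0 : lmodType R) (aug : {linear R^o -> E0})
    (x : R) i t (e : E0) :
  injective_module E0 -> injective aug -> m x ->
  (forall a, idealX m t a -> exists b, a = x * b) ->
  (forall j a, idealX m (j + i).+1 a ->
     exists2 b, idealX m (j + i) b & a = x * b) ->
  idealX m i `&` torsion m R^o = [set 0] ->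
  (forall c, m c -> exists r g, torsion m E0 g /\ c *: e = aug r + g) ->
  exists e', [/\ torsion m E0 (e' - e),
    forall a, idealX m i.+1 a -> exists r, a *: e' = aug r &
    forall c, m c -> exists r u,
      (forall a, idealX m i.+1 a -> a *: u = 0) /\ c *: e' = aug r + u].
Proof.
move=> injE augI mx tx divx mi0 soc.
have [r [g [[s gs] xe]]] := soc x mx.
have /choice[q qP] (a : submod (idealX m i.+1)) :
    exists b, idealX m i b /\ val a = x * b.
  by have [b mb ab] := divx 0%N _ (submod_valP a); exists b.
have q_lin : linear (fun a => r * q a : R^o).
  move=> k a a'; change (r * q (k *: a + a') = k * (r * q a) + r * q a').
  rewrite mulrCA -mulrDr; congr (r * _).
  have [[ma xa] [ma' xa']] := (qP a, qP a').
  have [mka xka] := qP (k *: a + a').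
  apply: (parameter_inj tx mi0 mka); first exact: (@submodZD _ _ (idealX m i)).
  by rewrite -xka mulrDr mulrCA -xa -xa'.
pose phi : {linear submod (idealX m i.+1) -> R^o} :=
  HB.pack (fun a => r * q a : R^o) (GRing.isLinear.Build R _ R^o _ _ q_lin).
have [h hE] := injE _ _ (val : {linear submod (idealX m i.+1) -> R^o})
  (aug \o phi) val_inj.
pose e' := h 1.
have e'E b : idealX m i b -> idealX m i.+1 (x * b) -> (x * b) *: e' = aug (r * b).
  move=> mb ma; have := hE (submod_sub ma); rewrite /= => hab.
  have [mq xq] := qP (submod_sub ma).
  rewrite -(parameter_inj tx mi0 mb mq xq) in hab.
  by rewrite -hab -linearZ /= [_ *: 1]mulr1.
have tors : torsion m E0 (e' - e).
  (* One more than s + i: dividing by x costs one power of m, and the quotient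
     must both kill the torsion part of x e and lie where x is injective. *)
  exists (s + i).+1 => a ma.
  have [b mb ab] := divx _ _ ma.
  have ma1 : idealX m i.+1 a by apply: (@idealX_addl _ _ s); rewrite addnS.
  rewrite ab scalerBr e'E; [|exact: idealX_addl mb|by rewrite -ab].
  rewrite mulrC -[in X in _ - X]mulrC -scalerA xe scalerDr gs; last first.
    by apply: (@idealX_addl _ _ i); rewrite addnC.
  by rewrite addr0 -linearZ subrr.
exists e'; split=> // [a ma|c mc].
  have [b mb ab] := divx 0%N a ma.
  by exists (r * b); rewrite ab e'E // -ab.
have [r' [g' [tg' ce]]] := soc c mc.
(* The torsion part of c e' collects that of c e and the correction c (e' - e). *)
have tu : torsion m E0 (g' + c *: (e' - e)).
  by apply: submodD => //; apply: submodZ.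
have ce' : c *: e' = aug r' + (g' + c *: (e' - e)).
  by rewrite addrA -ce -scalerDr addrCA subrr addr0.
exists r', (g' + c *: (e' - e)); split=> // a ma.
have [b mb ab] := divx 0%N a ma.
have auE : a *: (g' + c *: (e' - e)) = aug (c * (r * b) - a * r').
  have := congr1 (fun v => a *: v) ce'; rewrite scalerDr scalerA mulrC -scalerA.
  rewrite [in LHS]ab e'E // -?ab // -!linearZ.
  change (aug (c * (r * b)) = aug (a * r') + a *: (g' + c *: (e' - e)) -> 
    a *: (g' + c *: (e' - e)) = aug (c * (r * b) - a * r')).
  by move=> caE; apply/esym/eqP; rewrite linearB subr_eq addrC; apply/eqP.
rewrite auE; suff -> : c * (r * b) - a * r' = 0 by rewrite linear0.
suff : [set 0] (c * (r * b) - a * r' : R^o) by [].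
rewrite -mi0; split.
  apply: (@submodD _ _ (idealX m i)); first by do 2![apply: submodZ].
  by apply: submodN; rewrite mulrC; apply: submodZ; apply: idealX_decr.
have [l ul] := submodZ (A := torsion m E0) a tu.
exists l => k mk; apply: augI; rewrite linear0 linearZ /= -auE.
exact: ul.
Qed.

End Reduction.

Section Socle.
Variables (R : comNzRingType) (m : ideal R).
Variable E : injective_resolution (R^o : lmodType R).

Lemma res_aug_cocycle r : cx_d E 0 (res_aug E r) = 0.
Proof. by apply/res_exact0; exists r. Qed.

(** By exactness of [E] a first local cohomology class is [d e] with [e] in
    [E 0], and multiplying it by [c] gives zero iff [c e] is in
    [R + Gamma_m(E 0)]. *)
Lemma socle_class (w : local_cohomology m 1 E) :
  (forall c, m c -> c *: w = 0) ->
  exists z e, [/\ w = quot_pi (coboundaries (torsion_cx m E) 1) z,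
    val (val z : submod (torsion m (E 1))) = cx_d E 0 e &
    forall c, m c -> exists r g,
      torsion m (E 0) g /\ c *: e = res_aug E r + g].
Proof.
have [z <-] := quot_pi_surj w => zsoc.
have /res_exact[e ez] := congr1 val (submod_valP z).
exists z, e; split=> // c /zsoc; rewrite -linearZ => /quot_pi_eq0 [y yz].
have {yz} /= yz := congr1 val yz.
have /res_exact0[r rE] : cx_d E 0 (c *: e - val y) = 0.
  by rewrite linearB linearZ /= ez yz subrr.
exists r, (val y); split; last by rewrite rE subrK.
exact: (submod_valP (y : submod (torsion m (E 0)))).
Qed.

Lemma socle_lift i (e' : E 0) (z : submod (cocycles (torsion_cx m E) 1)) e :
  val (val z : submod (torsion m (E 1))) = cx_d E 0 e ->
  torsion m (E 0) (e' - e) ->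
  (forall a, idealX m i a -> exists r, a *: e' = res_aug E r) ->
  (forall c, m c -> exists r u,
     (forall a, idealX m i a -> a *: u = 0) /\ c *: e' = res_aug E r + u) ->
  exists w : Ext 1 (powquot m i) E, (forall c, m c -> c *: w = 0) /\
    Ext_to_local_cohomology m 1 i E w = quot_pi (coboundaries (torsion_cx m E) 1) z.
Proof.
move=> ze te' mie' soce'.
have [a /mie'[r rE]|f f1] := @quot_hom_ex _ (idealX m i) _ (cx_d E 0 e').
  by rewrite -linearZ /= rE res_aug_cocycle.
have df : cocycles (hom_cx (powquot m i) E) 1 f.
  apply: quot_hom_ext.
  by change (cx_d E 1 (f (quot_pi (idealX m i) 1)) = 0); rewrite f1 cx_dd.
exists (quot_pi _ (submod_sub df)); split=> [c /soce'[r [u [mu ce']]]|].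
  rewrite -linearZ; apply/quot_pi_eq0.
  have [h h1] := quot_hom_ex mu; exists h; apply: quot_hom_ext.
  change (cx_d E 0 (h (quot_pi (idealX m i) 1)) = c *: f (quot_pi (idealX m i) 1)).
  by rewrite h1 f1 -linearZ /= ce' linearD /= res_aug_cocycle add0r.
rewrite /Ext_to_local_cohomology cohomology_mapE; apply/quot_piP.
exists (submod_sub te'); apply: val_inj.
change (cx_d E 0 (e' - e) =
  f (quot_pi (idealX m i) 1) - val (val z : submod (torsion m (E 1)))).
by rewrite f1 ze linearB.
Qed.

End Socle.

Theorem theorem1p3 (R : comNzRingType) (m : ideal R)
    (E : injective_resolution (R^o : lmodType R)) (n : nat) :
  is_noetherian R ->
  is_local m ->
  krull_dim R 1 ->
  infinite_set [set: quotmod m] ->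
  least_nat (parameter_reduction m) n ->
  is_direct_limit (Ext_system m 1 E)
    (fun j => Ext_to_local_cohomology m 1 j E) /\
  forall i : nat, (n <= i)%N ->
    forall g : linHom (quotmod m) (local_cohomology m 1 E),
    exists f : linHom (quotmod m) (Ext 1 (powquot m i) E),
      hom_post (quotmod m) (Ext_to_local_cohomology m 1 i E) f = g.
Proof.
move=> _ _ dim1 _ [[n_gt0 [x xpar mnE] mn0] _].
split=> [|i ni g]; first exact: cohomology_direct_limit.
have [mx [t tx]] := parameter_dim1 dim1 xpar.
case: n n_gt0 mnE mn0 ni => // p _ /= mnE mp0.
case: i => // i; rewrite ltnS => pi.
have divx j a : idealX m (j + i).+1 a -> exists2 b, idealX m (j + i) b & a = x * b.
  rewrite -(subnK pi) addnA; apply: reduction_later => {}a.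
  by rewrite /= mnE; apply: idealM_span1.
have mi0 : idealX m i `&` torsion m R^o = [set 0].
  apply/seteqP; split=> [a [ma ta]|_ ->]; last by split; apply: submod0.
  by rewrite -mp0; split=> //; apply: (@idealX_addl _ _ (i - p)); rewrite subnK.
have gsoc c : m c -> c *: g (quot_pi m 1) = 0 by exact: quot_hom_killed.
have [z [e [gz ze soce]]] := socle_class gsoc.
have [e' [te' mie' soce']] := socle_representative (@res_injective _ _ E 0)
  (@res_aug_inj _ _ E) mx tx divx mi0 soce.
have [w [msoc wz]] := socle_lift ze te' mie' soce'.
have [f f1] := quot_hom_ex msoc; exists f; apply: quot_hom_ext.
change (Ext_to_local_cohomology m 1 i.+1 E (f (quot_pi m 1)) = g (quot_pi m 1)).
by rewrite f1 wz gz.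
Qed.
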